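(* Algorithm $\texttt{t}_2\texttt{HyTP()}$ (described in the context) is correct: on any integer-weighted multi-head $\texttt{t}_2$HyTN $\mathcal{H}_{\texttt{t}_2}=(\mathcal{T},\mathcal{A}\cup\mathcal{C}_{\texttt{t}_2})$ it returns an integer-valued feasible schedule $\varphi:\mathcal{T}\to\mathbb{Z}$ if $\mathcal{H}_{\texttt{t}_2}$ is consistent, and otherwise it correctly recognizes $\mathcal{H}_{\texttt{t}_2}$ as inconsistent. Moreover its running time is \[O\big((|\mathcal{T}|+|\mathcal{A}|)\cdot m_{\mathcal{A}}\cdot W_{\mathcal{A},\mathcal{C}_{\texttt{t}_2}}\big),\quad W_{\mathcal{A},\mathcal{C}_{\texttt{t}_2}}=\max\Big(\max_{A\in\mathcal{A}}\max_{h\in H_A}|w_A(h)|,\ \max\{l_j : l_j\text{ appears in some }\textstyle\bigvee_{i=1}^k(l_i\le X\le u_i)\in\mathcal{C}_{\texttt{t}_2}\}\Big).\]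
   Context: A multi-head $\texttt{t}_2$HyTN is $(\mathcal{T},\mathcal{A}\cup\mathcal{C}_{\texttt{t}_2})$ with $\mathcal{T}$ a finite set of time-points, $\mathcal{A}$ a finite set of multi-head hyperarcs $A=(t_A,H_A,w_A)$ (tail $t_A\in\mathcal{T}$, non-empty $H_A\subseteq\mathcal{T}\setminus\{t_A\}$, integer weights $w_A(v)$, $v\in H_A$), and $\mathcal{C}_{\texttt{t}_2}$ a finite set of constraints $\bigvee_{i=1}^k(l_i\le X\le u_i)$ with $X\in\mathcal{T}$, integer bounds ordered by $l_i<l_{i+1}$, $u_i<u_{i+1}$. A schedule $s$ is feasible if $s(t_A)\ge\min_{v\in H_A}\{s(v)-w_A(v)\}$ for all $A\in\mathcal{A}$ and all $\texttt{t}_2$-constraints hold. $|A|=|H_A\cup\{t_A\}|$ and $m_{\mathcal{A}}=\sum_{A\in\mathcal{A}}|A|$. VI denotes the value-iteration algorithm of Comin–Posenato–Rizzi for multi-head HyTNs $(\mathcal{T},\mathcal{A})$, which, started from an initial integer schedule, raises scheduling values monotonically and returns the least feasible schedule of $(\mathcal{T},\mathcal{A})$ pointwise above the initial one, or reports inconsistency (in total time $O((|\mathcal{T}|+|\mathcal{A}|)m_{\mathcal{A}}W)$ for weight bound $W$). Algorithm $\texttt{t}_2\texttt{HyTP()}$: run VI on $\mathcal{H}=(\mathcal{T},\mathcal{A})$; if inconsistent, report inconsistency; else let $\varphi$ be the returned least feasible schedule. While some $X\in\mathcal{T}$ and $c_X=\bigvee_{i=1}^k(l_i\le X\le u_i)\in\mathcal{C}_{\texttt{t}_2}$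 have $\varphi(X)$ not satisfying $c_X$: if $\varphi(X)>u_k$ report inconsistency; otherwise let $i^*$ be the smallest $i$ with $\varphi(X)<l_i$, set $\varphi(X)\leftarrow l_{i^*}$, and run VI on $(\mathcal{H},\varphi)$ (initialized at $\varphi$), letting $\varphi$ be the returned schedule. If the loop completes, return $\varphi$.
   Formalization: The stated time bound fails for negative l_j, for many constraints on one time-point, or when m_A or W is 0; it is proved with these excluded, and in general with |l_j| in W, an extra factor (max number of constraints per time-point) and zero factors replaced by 1. *)

(* Defs.v *)
From mathcomp Require Import all_boot all_order all_algebra.
From mathcomp Require Import reals.

Set Implicit Arguments.
Unset Strict Implicit.
Unset Printing Implicit Defensive.

Import Order.TTheory GRing.Theory Num.Theory.
Local Open Scope ring_scope.

(* [T] is the set of time-points; the hyperarcs and the t2-constraints are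
   families indexed by the finite types [E] and [C], so that a time-point may
   carry any number of t2-constraints.  [bounds c] lists the pairs (l_i, u_i)
   of the disjunction.  Disjuncts with u_i < l_i are not excluded. *)
Record t2hytn (T E C : finType) := T2HyTN {
  tail : E -> T;
  heads : E -> {set T};
  wt : E -> T -> int;
  var : C -> T;
  bounds : C -> seq (int * int);
  heads_neq0 : forall a, heads a != set0;
  tail_notin_heads : forall a, tail a \notin heads a;
  bounds_neq0 : forall c, (0 < size (bounds c))%N;
  bounds_sorted :
    forall c, sorted (fun p q => (p.1 < q.1) && (p.2 < q.2)) (bounds c)
}.

Section Network.
Variables (T E C : finType) (H : t2hytn T E C).

Section Feasibility.
Variable R : realDomainType.
Implicit Types s : T -> R.

Definition some_head (a : E) : T := xchoose (set0Pn _ (heads_neq0 H a)).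

(* min_{v in H_a} (s(v) - w_a(v)) *)
Definition headmin s (a : E) : R :=
  let F v := s v - (wt H a v)%:~R in
  F [arg min_(v < some_head a in heads H a) F v]%O.

Definition t2sat s (c : C) : bool :=
  has (fun p => p.1%:~R <= s (var H c) <= p.2%:~R) (bounds H c).

Definition feasible s : Prop :=
  (forall a, headmin s a <= s (tail H a)) /\ (forall c, t2sat s c).

Definition consistent : Prop := exists s, feasible s.

End Feasibility.

Definition mA : nat := (\sum_(a : E) #|tail H a |: heads H a|)%N.

Definition maxw : nat := (\max_(a : E) \max_(h in heads H a) `|wt H a h|)%N.

(* The maximum over an empty family of weights or bounds is 0. *)
Definition Wlit : int :=
  Num.max maxw%:Z
    (\big[Num.max/0]_(c : C) \big[Num.max/0]_(p <- bounds H c) p.1).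

(* [Wabs] equals [Wlit] when all l_j are nonnegative.  With negative l_j, the
   range of the l_j, and so the number of rounds, is not bounded by [Wlit]. *)
Definition Wabs : nat :=
  maxn maxw (\max_(c : C) \max_(p <- bounds H c) `|p.1|)%N.

(* The largest number of t2-constraints on a single time-point. *)
Definition load : nat := (\max_(x : T) #|[set c | var H c == x]|)%N.

(* ** The algorithm, as a transition system with costs

   Value iteration is the energy-game algorithm with a worklist and counters,
   run on the game whose nodes are time-points and hyperarcs, with an edge of
   weight 0 from [tail a] to [a] and an edge of weight [wt a v] from [a] to
   each head [v].  A value [f] on the nodes is stable at a time-point [x] if
   f(x) >= f(a) for all [a] with tail [x], and at a hyperarc [a] if
   f(a) >= min_v (f(v) - w_a(v)).

   The cost of a transition is the number of nodes, edges, constraints and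
   disjuncts it touches (unit-cost arithmetic).  All choices (node to lift,
   constraint to check) are left nondeterministic. *)

Notation node := (T + E)%type.

Record state := State {
  val_ : {ffun node -> int};
  (* for each hyperarc, the number of heads v with f(v) - w_a(v) <= f(a) *)
  cnt : {ffun E -> nat};
  (* the unstable nodes *)
  wl : {set node};
  (* the constraints not checked since their time-point was last raised *)
  pend : {set C};
  (* for each constraint, the number of disjuncts already scanned *)
  ptr : {ffun C -> nat}
}.

Definition phi (st : state) (x : T) : int := val_ st (inl x).

(* The hyperarc constraints are invariant under translation but the bounds of
   the t2-constraints are not: starting at 0 would miss schedules that give
   negative times to some time-points.  A consistent network has a feasible
   schedule above the constant [base]. *)
Definition base : int := - ((#|T|.+1 * Wabs)%N)%:Z.

(* From values at most [Wabs], value iteration on a consistent set of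
   hyperarcs never exceeds [cap]. *)
Definition cap : int := ((#|T|.+1 * Wabs)%N)%:Z.

Definition nsupp (f : T -> int) (z : int) (a : E) : nat :=
  #|[set v in heads H a | f v - wt H a v <= z]|.

Definition init : state :=
  State [ffun=> base]
    [ffun a => nsupp (fun=> base) base a]
    [set u : node | if u is inr a then nsupp (fun=> base) base a == 0%N
                    else false]
    [set: C] [ffun=> 0%N].

Definition init_cost : nat :=
  (#|T| + #|E| + mA + \sum_(c : C) (size (bounds H c)).+1)%N.

Definition lift (st : state) (u : node) : int :=
  match u with
  | inl x => \big[Num.max/phi st x]_(a | tail H a == x) val_ st (inr a)
  | inr a => Num.max (val_ st (inr a)) (headmin (phi st) a)
  end.

(* Raising time-point [x] to [z] removes [x] from the heads counted by [a]. *)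
Definition lost (st : state) (x : T) (z : int) (a : E) : bool :=
  [&& x \in heads H a, phi st x - wt H a x <= val_ st (inr a)
    & val_ st (inr a) < z - wt H a x].

Definition raise (st : state) (u : node) (z : int) : state :=
  let val' := [ffun u' => if u' == u then z else val_ st u'] in
  match u with
  | inl x =>
    let cnt' := [ffun a => (cnt st a - lost st x z a)%N] in
    State val' cnt'
      (wl st :\ u :|:
         [set inr a | a in [set a | lost st x z a && (cnt' a == 0%N)]])
      (pend st :|: [set c | var H c == x]) (ptr st)
  | inr a =>
    State val'
      [ffun b => if b == a then nsupp (phi st) z a else cnt st b]
      (wl st :\ u :|:
         (if phi st (tail H a) < z then [set inl (tail H a)] else set0))
      (pend st) (ptr st)
  end.

Definition outdeg (u : node) : nat :=
  match u with
  | inl x => #|[set a | tail H a == x]|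
  | inr a => #|heads H a|
  end.

Definition raise_cost (u : node) : nat :=
  match u with
  | inl x => (#|[set a | x \in heads H a]| + #|[set c | var H c == x]|).+1%N
  | inr a => 2
  end.

Definition lift_cost (u : node) : nat := (outdeg u + raise_cost u)%N.

(* The (0-based) smallest index i with phi(X) < l_i; it is the number of
   disjuncts if there is none. *)
Definition next_idx (st : state) (c : C) : nat :=
  find (fun p => phi st (var H c) < p.1) (bounds H c).

Definition next_l (st : state) (c : C) : int :=
  (nth (0, 0) (bounds H c) (next_idx st c)).1.

Definition last_u (c : C) : int := (last (0, 0) (bounds H c)).2.

Definition checked (st : state) (c : C) : state :=
  State (val_ st) (cnt st) (wl st) (pend st :\ c)
    [ffun b => if b == c then next_idx st c else ptr st b].

(* The search for [next_idx] resumes where the previous one stopped.  As the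
   u_i increase, phi(X) satisfies the constraint iff it is at most the u-bound
   of the disjunct just before [next_idx], which is one more comparison. *)
Definition check_cost (st : state) (c : C) : nat :=
  (next_idx st c - ptr st c).+1%N.

Inductive outcome := Returned of (T -> int) | Inconsistent.

Inductive config := Running of state | Halted of outcome.

Inductive step : state -> nat -> config -> Prop :=
| StepLift st u of u \in wl st & lift st u <= cap :
    step st (lift_cost u) (Running (raise st u (lift st u)))
| StepCap st u of u \in wl st & cap < lift st u :
    step st (lift_cost u) (Halted Inconsistent)
| StepSat st c of wl st = set0 & c \in pend st & t2sat (phi st) c :
    step st (check_cost st c) (Running (checked st c))
| StepOver st c of wl st = set0 & c \in pend st & ~~ t2sat (phi st) c
    & last_u c < phi st (var H c) :
    step st (check_cost st c) (Halted Inconsistent)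
| StepJump st c of wl st = set0 & c \in pend st & ~~ t2sat (phi st) c
    & phi st (var H c) <= last_u c :
    step st (check_cost st c + raise_cost (inl (var H c)))%N
      (Running (raise (checked st c) (inl (var H c)) (next_l st c)))
| StepReturn st of wl st = set0 & pend st = set0 :
    step st #|T|.+1 (Halted (Returned (phi st))).

(* [all_runs P cf n]: every run from [cf], entered with accumulated cost [n],
   halts after finitely many steps with an outcome [o] and a total cost [m]
   such that [P o m]. *)
Inductive all_runs (P : outcome -> nat -> Prop) : config -> nat -> Prop :=
| RunsHalted o n of P o n : all_runs P (Halted o) n
| RunsStep st n of (exists k cf, step st k cf)
    & (forall k cf, step st k cf -> all_runs P cf (n + k)%N) :
    all_runs P (Running st) n.

Definition t2HyTP_runs (P : outcome -> nat -> Prop) : Prop :=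
  all_runs P (Running init) init_cost.

End Network.

Arguments Inconsistent {T}.

(* Main.v *)
Require Import Defs.
From mathcomp Require Import all_boot all_order all_algebra zify.
From mathcomp Require Import reals.
Import Order.TTheory GRing.Theory Num.Theory.
Local Open Scope ring_scope.

(** Correctness rests on a normalisation: since all weights and all l_i are at
most [Wabs] in absolute value, an integer feasible schedule that leaves the
range from [base] to [cap] leaves an interval of width [Wabs] empty, and the
part beyond that gap can be shifted by one towards 0 without breaking a
constraint.  Every feasible schedule can thus be moved into the range, and
then it stays above the values computed by the algorithm, so no inconsistency
is ever reported wrongly.  For the cost, every node value only increases, and
each step is paid for by a potential in which lifts and jumps have separate
budgets: lifts may occur along the whole range but only at nodes with outgoing
edges, whereas jumps may occur at isolated time-points but land in
[- Wabs, Wabs]. *)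

(** A one-sided distance: truncation at 0 lets it measure both the excess beyond a bound and the
    budget left below one. *)
Definition posn (z : int) : nat := absz (Num.max 0 z).

Lemma sum_const (I : finType) (n : nat) : (\sum_(i : I) n = #|I| * n)%N.
Proof. exact: sum_nat_const. Qed.

(** * Real and integer feasible schedules *)

Section Network.
Variables (T E C : finType) (H : t2hytn T E C).

Lemma headmin_leP (R : realDomainType) (s : T -> R) (a : E) (z : R) :
  reflect (exists2 v, v \in heads H a & s v - (wt H a v)%:~R <= z)
    (headmin H s a <= z).
Proof.
rewrite /headmin; case: arg_minP => [|i ia imin].
  by rewrite /some_head; exact: (xchooseP (set0Pn _ (heads_neq0 H a))).
apply: (iffP idP) => [iz|[v va vz]]; first by exists i.
exact: le_trans (imin _ va) vz.
Qed.

Lemma feasible_int_real (R : realDomainType) (s : T -> int) :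
  feasible H s -> feasible H (fun x => (s x)%:~R : R).
Proof.
move=> [sA sC]; split=> [a|c].
- have /headmin_leP[v va svz] := sA a.
  by apply/headmin_leP; exists v => //; rewrite -intrB ler_int -[wt H a v]intz.
- apply: sub_has (sC c) => p /=.
  by rewrite !intz !ler_int.
Qed.

(** Weights and bounds are integers, so [floor] commutes with subtracting a weight, preserves
    integer lower bounds and only decreases values. *)
Lemma feasible_floor (R : realType) (s : T -> R) :
  feasible H s -> feasible H (fun x => Num.floor (s x)).
Proof.
move=> [sA sC]; split=> [a|c].
- have /headmin_leP[v va svz] := sA a.
  apply/headmin_leP; exists v => //.
  rewrite intz floor_ge_int intrB; apply: le_trans svz.
  by rewrite lerD2r floor_le.
- apply: sub_has (sC c) => p /= /andP[lp pu].
  rewrite !intz floor_ge_int lp -(ler_int R) /=.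
  exact: le_trans (floor_le _) pu.
Qed.

(** * Compressing feasible schedules into the range *)

Lemma wt_le_Wabs (a : E) (v : T) : v \in heads H a -> (absz (wt H a v) <= Wabs H)%N.
Proof.
move=> va; rewrite leq_max; apply/orP; left.
apply: leq_trans (@leq_bigmax_cond _ xpredT _ a isT).
exact: (@leq_bigmax_cond _ (mem (heads H a)) (fun h => absz (wt H a h))).
Qed.

Lemma bound_le_Wabs (c : C) (p : int * int) : p \in bounds H c -> (absz p.1 <= Wabs H)%N.
Proof.
move=> pc; rewrite leq_max; apply/orP; right.
apply: leq_trans (@leq_bigmax_cond _ xpredT _ c isT).
rewrite /=; exact: (@leq_bigmax_seq _ (bounds H c) xpredT (fun q : int * int => absz q.1) p pc isT).
Qed.

(* Pigeonhole on [#|T|] disjoint intervals of width [W]. *)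
Lemma exists_gap (g : T -> int) (W : nat) (x0 : T) :
  (#|T|.+1 * W)%N%:Z < g x0 ->
  exists2 k : nat, (k < #|T|)%N &
    forall x, (g x <= (k.+1 * W)%N%:Z) || ((k.+2 * W)%N%:Z < g x).
Proof.
move=> gx0.
have [/existsP[k /forallP gap]|/existsPn hit] := boolP [exists k : 'I_#|T|, forall x,
    (g x <= (k.+1 * W)%N%:Z) || ((k.+2 * W)%N%:Z < g x)].
  by exists k.
have {}hit (k : 'I_#|T|) : {x | (k.+1 * W)%N%:Z < g x <= (k.+2 * W)%N%:Z}.
  apply: sigW; have /forallPn[x] := hit k.
  by rewrite negb_or -ltNge -leNgt; exists x.
pose f (k : 'I_#|T|) := sval (hit k).
have fP (k : 'I_#|T|) : (k.+1 * W)%N%:Z < g (f k) <= (k.+2 * W)%N%:Z by exact: (svalP (hit k)).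
have lt_fk (i j : 'I_#|T|) : (i < j)%N -> f i <> f j.
  move=> ij fij; have := fP i; have := fP j; rewrite fij.
  have : (i.+2 * W <= j.+1 * W)%N by rewrite leq_mul2r; lia.
  lia.
have f_inj : injective f.
  move=> i j fij; apply: val_inj; case: (ltngtP i j) => // [/lt_fk//|/lt_fk].
  by rewrite fij.
(* An injection from [#|T|] indices into [T] is onto, so [x0] would lie in one of the intervals,
   although it exceeds the end of the last one. *)
have /codomP[k x0k] : x0 \in codom f by apply: inj_card_onto => //; rewrite card_ord.
have := fP k; rewrite -x0k => /andP[_].
have : (k.+2 * W <= #|T|.+1 * W)%N by rewrite leq_mul2r ltnS ltn_ord orbT.
lia.
Qed.

(** A head beyond the gap, once shifted, is still at least [Wabs] below any tail on the near side,
    which absorbs every weight. No t2-constraint sits on a shifted time-point, since values below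
    [- Y] are below every l_i. *)
Lemma feasible_shift_up (s : T -> int) (k : nat) (X := (k.+1 * Wabs H)%N%:Z)
    (Y := (k.+2 * Wabs H)%N%:Z) :
  feasible H s -> (forall x, (- s x <= X) || (Y < - s x)) ->
  feasible H (fun x => if Y < - s x then s x + 1 else s x).
Proof.
move=> [sA sC] gap.
have XY : Y = X + (Wabs H)%:Z by rewrite /X /Y; lia.
have X0 : (Wabs H)%:Z <= X by rewrite /X; lia.
split=> [a|c].
- have /headmin_leP[v va sv] := sA a.
  apply/headmin_leP; exists v => //; move: sv; rewrite !intz.
  have := wt_le_Wabs _ _ va; have := gap v; have := gap (tail H a).
  by case: ifP; case: ifP; lia.
- have /hasP[p pc ps] := sC c; apply/hasP; exists p => //.
  move: ps; rewrite !intz; have := bound_le_Wabs _ _ pc; have := gap (var H c).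
  by case: ifP; lia.
Qed.

(** A shifted tail stays at least [Wabs] above any head on the near side. Shifted values remain at
    least [Y], hence above every l_i, and moving down cannot violate a u_i. *)
Lemma feasible_shift_down (s : T -> int) (k : nat) (X := (k.+1 * Wabs H)%N%:Z)
    (Y := (k.+2 * Wabs H)%N%:Z) :
  feasible H s -> (forall x, (s x <= X) || (Y < s x)) ->
  feasible H (fun x => if Y < s x then s x - 1 else s x).
Proof.
move=> [sA sC] gap.
have XY : Y = X + (Wabs H)%:Z by rewrite /X /Y; lia.
have X0 : (Wabs H)%:Z <= X by rewrite /X; lia.
split=> [a|c].
- have /headmin_leP[v va sv] := sA a.
  apply/headmin_leP; exists v => //; move: sv; rewrite !intz.
  have := wt_le_Wabs _ _ va; have := gap v; have := gap (tail H a).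
  by case: ifP; case: ifP; lia.
- have /hasP[p pc ps] := sC c; apply/hasP; exists p => //.
  move: ps; rewrite !intz; have := bound_le_Wabs _ _ pc; have := gap (var H c).
  by case: ifP; lia.
Qed.

Definition in_range (s : T -> int) := forall x, base H <= s x <= cap H.

(** Induction on the total distance to the range: each shift moves an outlying [x0] closer and no
    time-point farther away. *)
Lemma feasible_in_range (s : T -> int) :
  feasible H s -> exists2 s', feasible H s' & in_range s'.
Proof.
pose dist (s : T -> int) := (\sum_x (posn (base H - s x)%R + posn (s x - cap H)%R))%N.
have [n] := ubnP (dist s); elim: n s => // n IHn s /ltnSE ds fs.
have [/forallP ?|/forallPn[x0 out]] := boolP [forall x, base H <= s x <= cap H].
  by exists s.
have lower (s' : T -> int) : feasible H s' ->
    (forall x, (posn (base H - s' x)%R + posn (s' x - cap H)%R <=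
               posn (base H - s x)%R + posn (s x - cap H)%R)%N) ->
    (posn (base H - s' x0)%R + posn (s' x0 - cap H)%R <
               posn (base H - s x0)%R + posn (s x0 - cap H)%R)%N ->
    exists2 s', feasible H s' & in_range s'.
  move=> fs' le_s' lt_s'; apply: (IHn s') => //; apply: leq_trans ds.
  by rewrite /dist (bigD1 x0) //= [ltnRHS](bigD1 x0) //= -addSn leq_add ?leq_sum.
have [sx0|sx0] := ltP (s x0) (base H).
- have [k kT gap] : exists2 k : nat, (k < #|T|)%N & forall x,
      (- s x <= (k.+1 * Wabs H)%N%:Z) || ((k.+2 * Wabs H)%N%:Z < - s x).
    by apply: (@exists_gap _ _ x0); move: sx0; rewrite /base; lia.
  (* The far end of the gap is at most [cap], so [x0] lies beyond it and is really shifted. *)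
  have kcap : (k.+2 * Wabs H <= #|T|.+1 * Wabs H)%N by rewrite leq_mul2r ltnS kT orbT.
  apply: (lower _ (feasible_shift_up _ _ fs gap)) => [x|].
    by case: ifP => // ?; rewrite /posn /base /cap; lia.
  by rewrite ifT; move: sx0; rewrite /posn /base /cap; lia.
- have [k kT gap] : exists2 k : nat, (k < #|T|)%N & forall x,
      (s x <= (k.+1 * Wabs H)%N%:Z) || ((k.+2 * Wabs H)%N%:Z < s x).
    by apply: (@exists_gap _ _ x0); move: sx0 out; rewrite /base /cap; lia.
  have kcap : (k.+2 * Wabs H <= #|T|.+1 * Wabs H)%N by rewrite leq_mul2r ltnS kT orbT.
  apply: (lower _ (feasible_shift_down _ _ fs gap)) => [x|].
    by case: ifP => // ?; rewrite /posn /base /cap; lia.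
  by rewrite ifT; move: sx0 out; rewrite /posn /base /cap; lia.
Qed.

(** * Invariants of the runs *)

Implicit Types (st : state T E C) (u : T + E) (s f : T -> int).

Lemma nsupp_eq0 f (z : int) (a : E) : (nsupp H f z a == 0%N) = (z < headmin H f a).
Proof.
rewrite ltNge -[LHS]negbK -lt0n; congr negb.
apply/card_gt0P/headmin_leP => -[v]; first by rewrite inE => /andP[]; exists v; rewrite ?intz.
by rewrite intz => va vz; exists v; rewrite inE va.
Qed.

Lemma lt_lift_inl st (x : T) :
  (phi st x < Defs.lift H st (inl x)) =
  [exists a, (tail H a == x) && (phi st x < val_ st (inr a))].
Proof.
rewrite /= ltNge -[RHS]negbK negb_exists; congr negb.
apply/bigmax_leP/forallP => [[_ ub] a|ub].
  by rewrite negb_and -implybE -leNgt; apply/implyP/ub.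
split=> // a ax; have := ub a.
by rewrite ax /= -leNgt.
Qed.

(** Justifies the counters: a hyperarc is unstable exactly when no head supports its current
    value. *)
Lemma lt_lift_inr st (a : E) :
  (val_ st (inr a) < Defs.lift H st (inr a)) =
  (nsupp H (phi st) (val_ st (inr a)) a == 0%N).
Proof. by rewrite /= nsupp_eq0 lt_max ltxx. Qed.

(** Counters and worklist are exact, whereas [ptr] is only a lower bound: raising a time-point moves
    [next_idx] without touching [ptr]. *)
Record coherent st : Prop := Coherent {
  cntE : forall a, cnt st a = nsupp H (phi st) (val_ st (inr a)) a;
  wlE : forall u, (u \in wl st) = (val_ st u < Defs.lift H st u);
  ptr_le : forall c, (ptr st c <= next_idx H st c)%N }.

Definition pend_sound st := forall c, c \notin pend st -> t2sat H (phi st) c.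

Lemma val_raise st u (z : int) u' :
  val_ (raise H st u z) u' = if u' == u then z else val_ st u'.
Proof. by case: u => ? /=; rewrite ffunE. Qed.

Lemma val_raise_ge st u (z : int) u' :
  val_ st u < z -> val_ st u' <= val_ (raise H st u z) u'.
Proof. by rewrite val_raise; case: eqP => // -> /ltW. Qed.

Lemma phi_raise_inl st (x : T) (z : int) (y : T) :
  phi (raise H st (inl x) z) y = if y == x then z else phi st y.
Proof. by rewrite /phi val_raise. Qed.

Lemma phi_raise_inr st (a : E) (z : int) : phi (raise H st (inr a) z) = phi st.
Proof. by apply: boolp.funext => x; rewrite /phi val_raise. Qed.

(** Only the head [x] can change status, and raising it can only withdraw support; [lost] detects
    precisely this. *)
Lemma nsupp_raise st (x : T) (z : int) (a : E) :
  phi st x < z ->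
  nsupp H (phi (raise H st (inl x) z)) (val_ st (inr a)) a =
  (nsupp H (phi st) (val_ st (inr a)) a - lost H st x z a)%N.
Proof.
move=> xz; rewrite /nsupp.
set S := [set v in _ | _ <= _] ; set S0 := [set v in _ | _ <= _].
have [lxa|lxa] := boolP (lost H st x z a).
  have [xa le_x lt_x] := and3P lxa.
  have -> : S = S0 :\ x.
    apply/setP => v; rewrite !inE phi_raise_inl; case: eqP => //= ->.
    by rewrite leNgt lt_x andbF.
  by rewrite [in RHS](cardsD1 x) inE xa le_x addKn.
rewrite subn0; congr #|pred_of_set _|; apply/setP => v; rewrite !inE phi_raise_inl.
case: eqP => // ->; case xa: (x \in heads H a) => //=.
by move: lxa; rewrite /lost xa /=; lia.
Qed.

(** Stated for any [z] above the lift, so that it covers jumps too. The game is bipartite: [u]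
    becomes stable, and the only nodes it can destabilise are the hyperarcs losing their last
    support or, for a hyperarc, its tail. *)
Lemma raise_coherent st u (z : int) :
  coherent st -> val_ st u < z -> Defs.lift H st u <= z ->
  coherent (raise H st u z).
Proof.
move=> [cE wE pE] uz lz; split=> [a|u'|c].
- case: u uz lz => [x|b] uz lz.
    by rewrite val_raise /= nsupp_raise // ffunE cE.
  rewrite phi_raise_inr val_raise /= ffunE cE.
  have -> : (inr a == inr b :> T + E) = (a == b) by [].
  by case: eqP => // ->.
- case: u uz lz => [x|b] uz lz; case: u' => [y|a].
  + rewrite lt_lift_inl inE phi_raise_inl !inE.
    have -> : (inl y == inl x :> T + E) = (y == x) by [].
    have -> : (inl y \in [set inr a | a in [set a | lost H st x z a &&
        ([ffun a0 => (cnt st a0 - lost H st x z a0)%N] a == 0%N)]] :> bool) = false.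
      by apply/negP => /imsetP[].
    case: eqP => [->|_] /=.
      apply/esym/existsP => -[a /andP[/eqP ax]].
      rewrite ffunE /= ltNge; move: lz => /bigmax_leP[_ ->] //.
      exact/eqP.
    rewrite orbF wE lt_lift_inl; apply: eq_existsb => a.
    by rewrite ffunE.
  + rewrite lt_lift_inr val_raise nsupp_raise //= -cE inE !inE wE lt_lift_inr -cE.
    rewrite mem_imset; last by move=> ? ? [->].
    (* If the count was already 0, truncated subtraction keeps it at 0. *)
    by rewrite inE ffunE; case: (lost _ _ _ _ _) => /=; rewrite ?subn0 ?orbF //; case: eqP => [->|].
  + rewrite lt_lift_inl phi_raise_inr inE !inE wE lt_lift_inl /=.
    apply/orP/existsP => [[/existsP[a /andP[ay lt_a]]|]|[a /andP[/eqP ay]]].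
    * exists a; rewrite ay ffunE; case: eqP => // -[ab].
      by apply: lt_trans uz; rewrite -ab.
    * case: ifP; rewrite !inE // => lt_z /eqP[->].
      by exists b; rewrite !eqxx ffunE eqxx.
    * rewrite ffunE; case: eqP => [[ab]|_] lt_y.
        by right; rewrite -ab ay lt_y inE.
      by left; apply/existsP; exists a; rewrite ay eqxx.
  + rewrite lt_lift_inr phi_raise_inr val_raise inE !inE wE lt_lift_inr.
    have -> : (inr a == inr b :> T + E) = (a == b) by [].
    have -> : (inr a \in (if phi st (tail H b) < z then [set inl (tail H b)] else set0)) = false.
      by case: ifP; rewrite !inE.
    rewrite orbF; case: eqP => //= ->; apply/esym.
    by rewrite nsupp_eq0 ltNge; move: lz; rewrite /= ge_max => /andP[_ ->].
- have -> : ptr (raise H st u z) = ptr st by case: (u).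
  (* Raising a value makes [phi(X) < l_i] hold for fewer disjuncts, so the first such index moves
     only to the right. *)
  apply: leq_trans (pE c) _; apply: sub_find => p /=.
  exact/le_lt_trans/val_raise_ge.
Qed.

Lemma raise_pend_sound st u (z : int) :
  pend_sound st -> pend_sound (raise H st u z).
Proof.
case: u => [x|a] ps c; last by rewrite phi_raise_inr; exact: ps.
rewrite /t2sat phi_raise_inl !inE negb_or => /andP[/ps cs /negbTE->].
exact: cs.
Qed.

Lemma checked_coherent st (c : C) : coherent st -> coherent (checked H st c).
Proof.
by move=> [cE wE pE]; split=> // b; rewrite /= ffunE; case: eqP => [->|].
Qed.

Lemma checked_pend_sound st (c : C) :
  pend_sound st -> t2sat H (phi st) c -> pend_sound (checked H st c).
Proof.
by move=> ps cs b; rewrite !inE negb_and negbK => /orP[/eqP->|/ps].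
Qed.

(** Checking removes the violated [c] from [pend], but the jump raises its own time-point and
    thereby puts [c] back. *)
Lemma jump_pend_sound st (c : C) (z : int) :
  pend_sound st -> pend_sound (raise H (checked H st c) (inl (var H c)) z).
Proof.
move=> ps b; rewrite /t2sat phi_raise_inl !inE negb_or negb_and negbK.
by case/andP=> /orP[/eqP->|/ps bs /negbTE->]; rewrite ?eqxx //; apply: bs.
Qed.

(** * Feasible schedules as upper bounds for the node values *)

Definition upper s u : int :=
  match u with inl x => s x | inr a => Num.max (base H) (headmin H s a) end.

(** The invariant that justifies every report of inconsistency. The [base] in [upper] is there
    because hyperarc nodes start at [base], which may exceed their [headmin]. *)
Definition below st :=
  forall s, feasible H s -> in_range s -> forall u, val_ st u <= upper s u.

Lemma raise_below st u (z : int) :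
  below st -> (forall s, feasible H s -> in_range s -> z <= upper s u) ->
  below (raise H st u z).
Proof.
move=> bst zs s fs rs u'; rewrite val_raise; case: eqP => [->|_]; first exact: zs.
exact: bst.
Qed.

Lemma upper_inr_le s (a : E) :
  feasible H s -> in_range s -> upper s (inr a) <= s (tail H a).
Proof.
by move=> [sA _] rs; rewrite ge_max sA; case/andP: (rs (tail H a)) => ->.
Qed.

Lemma upper_le_cap s u : feasible H s -> in_range s -> upper s u <= cap H.
Proof.
move=> fs rs; case: u => [x|a]; first by case/andP: (rs x).
by apply: le_trans (upper_inr_le _ _ fs rs) _; case/andP: (rs (tail H a)).
Qed.

(** Lifting is monotone in the node values, and by feasibility lifting the values [upper s] does not
    increase them. *)
Lemma lift_below st u s :
  below st -> feasible H s -> in_range s -> Defs.lift H st u <= upper s u.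
Proof.
move=> bst fs rs; have b := bst s fs rs; case: u => [x|a].
  apply/bigmax_leP; split=> [|a /eqP<-]; first exact: (b (inl x)).
  exact: le_trans (b (inr a)) (upper_inr_le _ _ fs rs).
rewrite /= ge_max (b (inr a)) /= le_max; apply/orP; right; apply/headmin_leP.
have /headmin_leP[v va sv] := lexx (headmin H s a); exists v => //.
by apply: le_trans sv; rewrite lerD2r; exact: (b (inl v)).
Qed.

Lemma bounds_ltn (c : C) (i j : nat) : (i < j < size (bounds H c))%N ->
  (nth (0, 0) (bounds H c) i).1 < (nth (0, 0) (bounds H c) j).1 /\
  (nth (0, 0) (bounds H c) i).2 < (nth (0, 0) (bounds H c) j).2.
Proof.
move=> /andP[ij js]; apply/andP.
apply: (sorted_ltn_nth _ (0, 0) (bounds_sorted H c)); rewrite ?inE //.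
  by move=> p q r /= /andP[qp1 qp2] /andP[pr1 pr2]; rewrite (lt_trans qp1) ?(lt_trans qp2).
exact: ltn_trans js.
Qed.

Lemma last_uE (c : C) :
  last_u H c = (nth (0, 0) (bounds H c) (size (bounds H c)).-1).2.
Proof. by rewrite nth_last. Qed.

Lemma le_last_u (c : C) (p : int * int) : p \in bounds H c -> p.2 <= last_u H c.
Proof.
move=> /(nthP (0, 0))[i ic <-]; rewrite last_uE.
have [->//|ilast] := eqVneq i (size (bounds H c)).-1.
have /bounds_ltn[_ /ltW //] : (i < (size (bounds H c)).-1 < size (bounds H c))%N.
by move: ic ilast; case: (size _) => // n; lia.
Qed.

(** Violating the last disjunct without exceeding its u-bound leaves only [phi(X) < l_k], so the
    search succeeds. *)
Lemma next_idx_ltn st (c : C) :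
  ~~ t2sat H (phi st) c -> phi st (var H c) <= last_u H c ->
  (next_idx H st c < size (bounds H c))%N.
Proof.
move=> /hasPn unsat le_u; rewrite -has_find; apply/hasP.
have c0 := bounds_neq0 H c.
have lastc : nth (0, 0) (bounds H c) (size (bounds H c)).-1 \in bounds H c.
  by rewrite mem_nth // ltn_predL.
exists (nth (0, 0) (bounds H c) (size (bounds H c)).-1) => //=.
have := unsat _ lastc.
by rewrite /= !intz -last_uE le_u andbT -ltNge.
Qed.

Lemma jump_lt st (c : C) :
  ~~ t2sat H (phi st) c -> phi st (var H c) <= last_u H c ->
  phi st (var H c) < next_l H st c.
Proof.
move=> unsat le_u; have := next_idx_ltn _ _ unsat le_u.
by rewrite -has_find => /(nth_find (0, 0)).
Qed.

Lemma jump_range st (c : C) :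
  ~~ t2sat H (phi st) c -> phi st (var H c) <= last_u H c ->
  (absz (next_l H st c) <= Wabs H)%N.
Proof.
move=> unsat le_u; apply: (@bound_le_Wabs c).
exact/mem_nth/next_idx_ltn.
Qed.

(** Take the disjunct that [s] satisfies. Since phi(X) <= s(X) <= u_j, the current value can violate
    it only by lying below l_j; hence the search stops at j or earlier, and the l_i increase. *)
Lemma jump_below st (c : C) s :
  below st -> ~~ t2sat H (phi st) c -> feasible H s -> in_range s ->
  next_l H st c <= s (var H c).
Proof.
move=> bst /hasPn unsat fs rs; have /hasP[p pc] := fs.2 c; rewrite !intz.
move/(nthP (0, 0)): (pc) => [j jc pj] /andP[lp pu].
have phis := bst s fs rs (inl (var H c)).
have lt_p : phi st (var H c) < p.1.
  have := unsat _ pc; rewrite /= !intz negb_and -!ltNge => /orP[//|].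
  by move/lt_le_trans/(_ (le_trans phis pu)); rewrite ltxx.
have idx_j : (next_idx H st c <= j)%N.
  rewrite leqNgt; apply/negP => /(before_find (0, 0)).
  by rewrite pj lt_p.
apply: le_trans lp; rewrite -pj /next_l.
have [->//|idx_neq] := eqVneq (next_idx H st c) j.
have /bounds_ltn[/ltW //] : (next_idx H st c < j < size (bounds H c))%N.
by rewrite ltn_neqAle idx_neq idx_j.
Qed.

Lemma over_infeasible st (c : C) s :
  below st -> last_u H c < phi st (var H c) -> feasible H s -> in_range s -> False.
Proof.
move=> bst over fs rs; have /hasP[p pc] := fs.2 c; rewrite !intz => /andP[_ pu].
have := bst s fs rs (inl (var H c)); have := le_last_u _ _ pc; move: over pu.
by rewrite /phi /=; lia.
Qed.

(** With an empty worklist every node is stable, and the value of the hyperarc node links [headmin]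
    to the value of its tail. *)
Lemma stable_feasible st :
  coherent st -> pend_sound st -> wl st = set0 -> pend st = set0 ->
  feasible H (phi st).
Proof.
move=> cst ps wl0 pend0; split=> [a|c]; last by apply: ps; rewrite pend0 inE.
have stable u : Defs.lift H st u <= val_ st u.
  by rewrite leNgt -(wlE _ cst) wl0 inE.
have /bigmax_leP[_ /(_ a (eqxx _))] := stable (inl (tail H a)).
by apply: le_trans; have := stable (inr a); rewrite /= ge_max => /andP[].
Qed.

(** * The initial state *)

Lemma init_coherent : coherent (init H).
Proof.
have phi0 : phi (init H) = fun=> base H.
  by apply: boolp.funext => x; rewrite /phi ffunE.
split=> [a|[x|a]|c]; last by rewrite ffunE.
- by rewrite phi0 !ffunE.
- by rewrite lt_lift_inl inE phi0; apply/esym/existsP => -[a]; rewrite ffunE ltxx andbF.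
- by rewrite lt_lift_inr inE phi0 ffunE.
Qed.

Lemma init_pend_sound : pend_sound (init H).
Proof. by move=> c; rewrite inE. Qed.

Lemma init_below : below (init H).
Proof.
move=> s fs rs [x|a]; rewrite ffunE /=; first by case/andP: (rs x).
by rewrite le_max lexx.
Qed.

(** * The remaining cost *)

(* Each raise of a time-point puts its constraints back into [pend]; the
   summand [load] prepays the unit cost of checking them again. *)
Definition lift_weight u : nat := (lift_cost H u + load H)%N.

Definition jump_weight (x : T) : nat := (raise_cost H (inl x) + load H)%N.

(* Only nodes with an outgoing edge are ever lifted. *)
Definition lift_potential st : nat :=
  (\sum_(u | (0 < outdeg H u)%N) posn (cap H - val_ st u)%R * lift_weight u)%N.

(* Jumps land in [- Wabs, Wabs], so the budget of a time-point for jumps does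
   not depend on [#|T|], unlike its budget for lifts. *)
Definition jump_potential st : nat :=
  (\sum_(x : T) minn (Wabs H).*2.+1 (posn ((Wabs H)%:Z - phi st x)%R) * jump_weight x)%N.

Definition scan_potential st : nat :=
  (\sum_(c : C) (size (bounds H c) - ptr st c))%N.

Definition potential st : nat :=
  (lift_potential st + jump_potential st + #|pend st| + scan_potential st)%N.

(* Pays for the halting step: a lift beyond [cap] is not covered by the
   potential. *)
Definition halt_cost : nat := (#|T| + 2 * #|E| + mA H + load H + 3)%N.

Lemma lift_potential_raise st u (z : int) : val_ st u < z ->
  (lift_potential (raise H st u z) <= lift_potential st)%N.
Proof.
move=> uz; apply: leq_sum => u' _; rewrite leq_mul2r; apply/orP; right.
by have := val_raise_ge st u z u' uz; rewrite /posn; lia.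
Qed.

Lemma lift_potential_lift st u (z : int) :
  (0 < outdeg H u)%N -> val_ st u < z <= cap H ->
  (lift_potential (raise H st u z) + lift_weight u <= lift_potential st)%N.
Proof.
move=> u_out /andP[uz zc]; rewrite /lift_potential (bigD1 u) //= [leqRHS](bigD1 u) //= addnAC -mulSnr.
apply: leq_add.
  by rewrite leq_mul2r val_raise eqxx /posn; apply/orP; right; lia.
apply: leq_sum => u' _; rewrite leq_mul2r; apply/orP; right.
by have := val_raise_ge st u z u' uz; rewrite /posn; lia.
Qed.

Lemma jump_potential_raise st u (z : int) : val_ st u < z ->
  (jump_potential (raise H st u z) <= jump_potential st)%N.
Proof.
move=> uz; apply: leq_sum => x _; rewrite leq_mul2r; apply/orP; right.
by have := val_raise_ge st u z (inl x) uz; rewrite /phi /posn; lia.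
Qed.

(** After the jump the remaining distance to [Wabs] is at most twice [Wabs], below the truncation
    level [(Wabs H).*2.+1]; so the minimum drops even if the old value was far below [- Wabs]. *)
Lemma jump_potential_jump st (x : T) (z : int) :
  phi st x < z -> (absz z <= Wabs H)%N ->
  (jump_potential (raise H st (inl x) z) + jump_weight x <= jump_potential st)%N.
Proof.
move=> xz zW; rewrite /jump_potential (bigD1 x) // [leqRHS](bigD1 x) // addnAC -mulSnr.
apply: leq_add.
  by rewrite leq_mul2r phi_raise_inl eqxx /posn; apply/orP; right; lia.
apply: leq_sum => y _; rewrite leq_mul2r; apply/orP; right.
by have := val_raise_ge st (inl x) z (inl y) xz; rewrite /phi /posn; lia.
Qed.

Lemma card_var_le_load (x : T) : (#|[set c | var H c == x]| <= load H)%N.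
Proof. exact: (@leq_bigmax_cond _ xpredT (fun y => #|[set c | var H c == y]|)). Qed.

Lemma card_pend_raise st u (z : int) :
  (#|pend (raise H st u z)| <= #|pend st| + load H)%N.
Proof.
case: u => [x|a] /=; last exact: leq_addr.
by apply: leq_trans (leq_card_setU _ _) _; rewrite leq_add2l card_var_le_load.
Qed.

Lemma card_pend_checked st (c : C) :
  c \in pend st -> #|pend st| = #|pend (checked H st c)|.+1.
Proof. by move=> cp; rewrite (cardsD1 c) cp. Qed.

(** Each disjunct is passed over once in a whole run, as the pointer never moves back. *)
Lemma scan_potential_checked st (c : C) : coherent st ->
  (scan_potential (checked H st c) + (next_idx H st c - ptr st c) = scan_potential st)%N.
Proof.
move=> cst; rewrite /scan_potential (bigD1 c) //= [RHS](bigD1 c) //= ffunE eqxx addnAC.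
congr (_ + _)%N.
  by have := ptr_le _ cst c; have : (next_idx H st c <= size (bounds H c))%N by
    [exact: find_size]; lia.
by apply: eq_bigr => b /negbTE bc; rewrite ffunE bc.
Qed.

Lemma unstable_outdeg st u : val_ st u < Defs.lift H st u -> (0 < outdeg H u)%N.
Proof.
case: u => [x|a] ltu; last by rewrite /= card_gt0 heads_neq0.
move: ltu; rewrite lt_lift_inl => /existsP[a /andP[ax _]].
by apply/card_gt0P; exists a; rewrite inE.
Qed.

Lemma mAE : mA H = (\sum_(a : E) #|heads H a| + #|E|)%N.
Proof.
rewrite -sum1_card -big_split /=; apply: eq_bigr => a _.
by rewrite cardsU1 tail_notin_heads addnC.
Qed.

Lemma lift_cost_halt u : (lift_cost H u <= halt_cost)%N.
Proof.
rewrite /lift_cost /halt_cost; case: u => [x|a] /=.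
  have := max_card [set a | tail H a == x]; have := max_card [set a | x \in heads H a].
  by have := card_var_le_load x; move: (mA H) #|E|; lia.
by have := mAE; rewrite (bigD1 a) //=; lia.
Qed.

(** * Soundness, progress and termination of all runs *)

Definition outcome_sound (o : outcome T) : Prop :=
  match o with
  | Returned f => feasible H f
  | Inconsistent => ~ exists s : T -> int, feasible H s
  end.

Lemma step_exists st : coherent st -> pend_sound st -> exists k cf, step H st k cf.
Proof.
move=> cst ps; have [wl0|[u uwl]] := set_0Vmem (wl st); last first.
  have [le_cap|gt_cap] := leP (Defs.lift H st u) (cap H); do 2 eexists.
    exact: StepLift uwl le_cap.
  exact: StepCap uwl gt_cap.
have [pend0|[c cp]] := set_0Vmem (pend st); first by do 2 eexists; apply: StepReturn.
have [sat|unsat] := boolP (t2sat H (phi st) c).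
  by do 2 eexists; apply: StepSat sat.
have [le_u|gt_u] := leP (phi st (var H c)) (last_u H c); do 2 eexists.
  exact: StepJump unsat le_u.
exact: StepOver unsat gt_u.
Qed.

(** Strong induction on the potential. Every non-halting step costs at least 1 and lowers the
    potential by at least its cost, which gives termination and the bound [B] together. *)
Lemma runs_sound (P : outcome T -> nat -> Prop) (B : nat) :
  (forall o m, outcome_sound o -> (m <= B)%N -> P o m) ->
  forall st n, coherent st -> pend_sound st -> below st ->
  (n + potential st + halt_cost <= B)%N -> all_runs H P (Running st) n.
Proof.
move=> PB st n; have [k] := ubnP (potential st).
elim: k => // k IHk in st n * => /ltnSE potk cst ps bst leB.
(* By compression it suffices to refute the feasible schedules within the range. *)
have infeasible : (forall s, feasible H s -> in_range s -> False) ->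
    outcome_sound Inconsistent.
  by move=> no [s /feasible_in_range[s' fs' /no]]; apply.
have IH st' m : coherent st' -> pend_sound st' -> below st' -> (0 < m)%N ->
    (potential st' + m <= potential st)%N -> all_runs H P (Running st') (n + m).
  by move=> *; apply: IHk => //; lia.
apply: RunsStep => [|m cf stp]; first exact: step_exists.
case: st m cf / stp potk cst ps bst leB IH
  => [st u uwl le_cap|st u uwl gt_cap|st c wl0 cp sat|st c wl0 cp unsat gt_u
     |st c wl0 cp unsat le_u|st wl0 pend0] potk cst ps bst leB IH.
- have ltu : val_ st u < Defs.lift H st u by rewrite -(wlE _ cst).
  have u_out := unstable_outdeg _ _ ltu.
  apply: IH.
  + exact: raise_coherent.
  + exact: raise_pend_sound.
  + by apply: raise_below => // s; exact: lift_below.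
  + by rewrite ltn_addr.
  + have := lift_potential_lift st u (Defs.lift H st u) u_out.
    have := jump_potential_raise st u (Defs.lift H st u) ltu.
    have := card_pend_raise st u (Defs.lift H st u).
    have : scan_potential (raise H st u (Defs.lift H st u)) = scan_potential st.
      by case: (u).
    rewrite ltu le_cap /potential /lift_weight => -> ? ? /(_ isT). lia.
(* A lift stays below [upper s], which is at most [cap]; exceeding [cap] therefore excludes every
   such [s]. *)
- apply/RunsHalted/PB.
    apply: infeasible => s fs rs; have := lift_below st u s bst fs rs.
    by move=> /(lt_le_trans gt_cap)/lt_le_trans/(_ (upper_le_cap s u fs rs)); rewrite ltxx.
  by have := lift_cost_halt u; lia.
- apply: IH.
  + exact: checked_coherent.
  + exact: checked_pend_sound.
  + exact: bst.
  + by [].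
  + have := scan_potential_checked st c cst; have := card_pend_checked st c cp.
    rewrite /potential /check_cost.
    have -> : lift_potential (checked H st c) = lift_potential st by [].
    have -> : jump_potential (checked H st c) = jump_potential st by [].
    by lia.
- apply/RunsHalted/PB.
    by apply: infeasible => s; exact: over_infeasible bst gt_u.
  have := scan_potential_checked st c cst; have := card_pend_checked st c cp.
  by move: leB; rewrite /potential /check_cost; lia.
- set z := next_l H st c; set st' := checked H st c.
  have ltz : phi st' (var H c) < z by exact: jump_lt.
  apply: IH.
  + apply: raise_coherent => //; first exact: checked_coherent.
    (* The worklist is empty, so the time-point is stable and its lift is at most its old value. *)
    apply: le_trans (ltW ltz); rewrite leNgt.
    by have := wlE _ cst (inl (var H c)); rewrite wl0 inE => <-.
  + exact: jump_pend_sound.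
  + by apply: raise_below => // s; exact: jump_below.
  + by rewrite addn_gt0.
  + have := lift_potential_raise st' (inl (var H c)) z ltz.
    have := jump_potential_jump st' (var H c) z ltz (jump_range _ _ unsat le_u).
    have := card_pend_raise st' (inl (var H c)) z.
    have := card_pend_checked st c cp; have := scan_potential_checked st c cst.
    rewrite /potential /jump_weight /check_cost -/st'.
    have -> : lift_potential st = lift_potential st' by [].
    have -> : jump_potential st = jump_potential st' by [].
    have -> : scan_potential (raise H st' (inl (var H c)) z) = scan_potential st' by [].
    by lia.
- apply/RunsHalted/PB; first exact: stable_feasible.
  by move: leB; rewrite /halt_cost; lia.
Qed.

(** * The total cost *)

(** The l_i are distinct integers in [- Wabs, Wabs]; translating by [Wabs] makes them distinct
    naturals below the bound. *)
Lemma size_bounds_le (c : C) : (size (bounds H c) <= (Wabs H).*2.+1)%N.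
Proof.
pose f (p : int * int) := absz (p.1 + (Wabs H)%:Z).
have f_sorted : sorted ltn (map f (bounds H c)).
  apply: (homo_sorted_in (P := mem (bounds H c))) (bounds_sorted H c); last exact/allP.
  move=> [p p'] [q q'] pc qc /andP[/= pq _]; rewrite /f /=.
  by have := bound_le_Wabs _ _ pc; have := bound_le_Wabs _ _ qc; move: pq => /=; lia.
rewrite -(size_map f) -(size_iota 0 (Wabs H).*2.+1); apply: uniq_leq_size.
  exact: sorted_uniq ltn_trans ltnn _ f_sorted.
move=> _ /mapP[p pc ->]; rewrite mem_iota /f.
by have := bound_le_Wabs _ _ pc; lia.
Qed.

Lemma card_constraints_le : (#|C| <= load H * #|T|)%N.
Proof.
rewrite -sum1_card (partition_big (var H) xpredT) //= mulnC -sum_const.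
by apply: leq_sum => x _; rewrite sum1dep_card card_var_le_load.
Qed.

Lemma sum_card_heads :
  (\sum_(x : T) #|[set a | x \in heads H a]| = \sum_(a : E) #|heads H a|)%N.
Proof.
transitivity (\sum_(x : T) \sum_(a : E) (x \in heads H a))%N.
  by apply: eq_bigr => x _; rewrite -sum1_card big_mkcond; apply: eq_bigr => a _; rewrite inE.
rewrite exchange_big; apply: eq_bigr => a _.
by rewrite -sum1_card [RHS]big_mkcond.
Qed.

Lemma sum_card_tail : (\sum_(x : T) #|[set a | tail H a == x]| = #|E|)%N.
Proof.
rewrite -[RHS]sum1_card (partition_big (tail H) xpredT) //=.
by apply: eq_bigr => x _; rewrite sum1dep_card.
Qed.

(** A time-point counted here has an outgoing hyperarc, so its constant and [load] costs can be
    charged to such hyperarcs. This avoids a term in [#|T|], which the length of the lifting range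
    would turn into a square. *)
Lemma lift_weight_sum :
  (\sum_(u | (0 < outdeg H u)%N) lift_weight u
   <= 2 * mA H + #|E| * (2 + 3 * load H))%N.
Proof.
rewrite big_sumType /= mAE.
apply: (@leq_trans
  (\sum_(x : T) (#|[set a | x \in heads H a]| +
                 #|[set a | tail H a == x]| * (2 + 2 * load H)) +
   \sum_(a : E) (#|heads H a| + (2 + load H)))%N).
  apply: leq_add; last first.
    rewrite big_mkcond; apply: leq_sum => a _; case: ifP => // _.
    by rewrite /lift_weight /lift_cost /=; lia.
  rewrite big_mkcond; apply: leq_sum => x _; case: ifP => // out.
  rewrite /lift_weight /lift_cost /=; have := card_var_le_load x.
  move: out; case: #|[set a | tail H a == x]| => // k _ vx.
  move: vx #|[set a | _]| => vx i; rewrite mulSn; nia.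
rewrite !big_split /= sum_card_heads -big_distrl /= sum_card_tail !sum_const.
by move: (bigop _ _ _) #|E| => h e; nia.
Qed.

(** Lifts are charged over the whole distance from [base] to [cap], jumps only over the width
    [(Wabs H).*2.+1]. *)
Lemma init_potential_le :
  (potential (init H) <=
   (#|T|.+1 * Wabs H).*2 * (2 * mA H + #|E| * (2 + 3 * load H)) +
   (Wabs H).*2.+1 * (mA H + #|T| * (1 + 2 * load H)) + #|C| + #|C| * (Wabs H).*2.+1)%N.
Proof.
apply: leq_add; [apply: leq_add; [apply: leq_add|]|].
- apply: leq_trans _ (leq_mul (leqnn _) lift_weight_sum).
  rewrite big_distrr; apply: leq_sum => u _; rewrite leq_mul2r ffunE /posn /cap /base.
  by apply/orP; right; lia.
- apply: (@leq_trans (\sum_(x : T) (Wabs H).*2.+1 * jump_weight x)%N).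
    by apply: leq_sum => x _; rewrite leq_mul2r geq_minl orbT.
  rewrite -big_distrr leq_mul2l /jump_weight /=.
  apply: (@leq_trans (\sum_(x : T) (#|[set a | x \in heads H a]| + (1 + 2 * load H)))%N).
    by apply: leq_sum => x _; have := card_var_le_load x; lia.
  by rewrite big_split /= sum_card_heads sum_const mAE leq_add2r leq_addr.
- by rewrite cardsT.
- rewrite -sum_const; apply: leq_sum => c _.
  exact: leq_trans (leq_subr _ _) (size_bounds_le c).
Qed.

Lemma init_cost_le :
  (init_cost H <= #|T| + #|E| + mA H + #|C| * (Wabs H).*2.+2)%N.
Proof.
by rewrite leq_add2l -sum_const; apply: leq_sum => c _; rewrite ltnS size_bounds_le.
Qed.

(** Using [maxn 1] keeps all four factors positive, so each monomial of the cost is bounded by a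
    multiple of their product [Q]. *)
Lemma total_cost_le :
  (init_cost H + potential (init H) + halt_cost <=
   100 * (maxn 1 (load H) * maxn 1 (#|T| + #|E|) * maxn 1 (mA H) * maxn 1 (Wabs H)))%N.
Proof.
have := init_cost_le; have := init_potential_le; have := card_constraints_le.
have : (#|E| <= mA H)%N by rewrite mAE leq_addl.
rewrite /halt_cost; move: (init_cost H) (potential _) #|C| #|T| #|E| => i p c n e.
move: (mA H) (load H) (Wabs H) => m l w em cl pb ib.
have [nN mM lL wW] : [/\ n + e <= maxn 1 (n + e), m <= maxn 1 m, l <= maxn 1 l
  & w <= maxn 1 w]%N by rewrite !leq_maxr.
have [N1 M1 L1 W1] : [/\ 0 < maxn 1 (n + e), 0 < maxn 1 m, 0 < maxn 1 l
  & 0 < maxn 1 w]%N by rewrite !leq_max.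
move: (maxn _ (n + e)) (maxn _ m) (maxn _ l) (maxn _ w) nN mM lL wW N1 M1 L1 W1.
move=> N M L W nN mM lL wW N1 M1 L1 W1; set Q := (L * N * M * W)%N.
have prod (a b x y : nat) : (a <= L -> b <= N -> x <= M -> y <= W -> a * b * x * y <= Q)%N.
  by move=> *; rewrite !leq_mul.
have n_le : (n <= N)%N by lia.
have e_le : (e <= M)%N by lia.
have liftQ : ((n.+1 * w).*2 * (2 * m + e * (2 + 3 * l)) <= 28 * Q)%N.
  (* Here n + 1 <= 2N, and 2m + e(2 + 3l) <= 7LM, whence 2 * 2 * 7 = 28. *)
  have -> : (28 * Q = (2 * N * W).*2 * (7 * (L * M)))%N by rewrite /Q; lia.
  apply: leq_mul; first by rewrite leq_double leq_mul //; lia.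
  have : (m <= L * M)%N by rewrite -[m]mul1n leq_mul.
  have : (e <= L * M)%N by rewrite -[e]mul1n leq_mul.
  have : (l * e <= L * M)%N by rewrite leq_mul.
  by lia.
have jumpQ : (w.*2.+1 * (m + n * (1 + 2 * l)) <= 12 * Q)%N.
  have := prod 1%N 1%N m w; have := prod 1%N 1%N m 1%N.
  have := prod 1%N n 1%N w; have := prod 1%N n 1%N 1%N.
  have := prod l n 1%N w; have := prod l n 1%N 1%N.
  by rewrite !mul1n !muln1 => /(_ lL n_le M1 W1) ? /(_ lL n_le M1 wW) ?
    /(_ L1 n_le M1 W1) ? /(_ L1 n_le M1 wW) ? /(_ L1 N1 mM W1) ? /(_ L1 N1 mM wW) ?; lia.
have cQ : (c <= Q)%N.
  by apply: leq_trans cl _; have := prod l n 1%N 1%N lL n_le M1 W1; rewrite !muln1.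
have cwQ : (c * w <= Q)%N.
  apply: (@leq_trans (l * n * w)); first by rewrite leq_mul2r cl orbT.
  by have := prod l n 1%N w lL n_le M1 wW; rewrite muln1.
have nQ : (n <= Q)%N by have := prod 1%N n 1%N 1%N L1 n_le M1 W1; rewrite !muln1 mul1n.
have mQ : (m <= Q)%N by have := prod 1%N 1%N m 1%N L1 N1 mM W1; rewrite muln1 !mul1n.
have lQ : (l <= Q)%N by have := prod l 1%N 1%N 1%N lL N1 M1 W1; rewrite !muln1.
have Q1 : (0 < Q)%N by rewrite !muln_gt0 L1 N1 M1.
(* Initialisation contributes at most 7 [Q], the potential 44 [Q] and the halting step 8 [Q]. *)
by lia.
Qed.

(** [Posz] commutes with maxima, so the integer and natural maxima agree term by term once the
    absolute values disappear. *)
Lemma Wlit_nonneg : (forall (c : C) (p : int * int), p \in bounds H c -> 0 <= p.1) ->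
  Wlit H = (Wabs H)%:Z.
Proof.
have max_morph : {morph Posz : m n / maxn m n >-> Num.max m n} by move=> m n; lia.
move=> l_ge0; rewrite /Wabs max_morph; congr Num.max.
rewrite (big_morph _ max_morph (erefl 0)); apply: eq_bigr => c _.
rewrite (big_morph _ max_morph (erefl 0)); apply: eq_big_seq => p pc.
by rewrite gez0_abs ?(l_ge0 c).
Qed.

End Network.

Theorem theorem10 :
  exists K : nat,
  forall (R : realType) (T E C : finType) (H : t2hytn T E C),
  t2HyTP_runs H (fun (o : outcome T) (time : nat) =>
    [/\ consistent H R ->
          exists phi : T -> int, o = Returned phi /\ feasible H phi,
        ~ consistent H R -> o = Inconsistent,
        [/\ (load H <= 1)%N,
            (forall (c : C) (p : int * int), p \in bounds H c -> 0 <= p.1),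
            (0 < mA H)%N & 0 < Wlit H] ->
          time%:Z <= K%:Z * (((#|T| + #|E|) * mA H)%N%:Z * Wlit H)
      & (time <= K * (maxn 1 (load H) * maxn 1 (#|T| + #|E|)
                      * maxn 1 (mA H) * maxn 1 (Wabs H)))%N]).
Proof.
exists 100%N => R T E C H.
apply: runs_sound (total_cost_le _ _ _ H) => [o m o_sound m_le|||];
  [split=> // | exact: init_coherent | exact: init_pend_sound | exact: init_below].
- move=> [s fs]; case: o o_sound => [f ff|[]]; first by exists f.
  (* The reported inconsistency concerns integer schedules; the floor of a real schedule contradicts
     it. *)
  by exists (fun x => Num.floor (s x)); exact: feasible_floor.
- move=> incons; case: o o_sound => // f ff; case: incons.
  by exists (fun x => (f x)%:~R); exact: feasible_int_real.
- move=> [load1 l_ge0 mA_gt0 W_gt0]; move: W_gt0; rewrite Wlit_nonneg // => W_gt0.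
  (* A positive [mA] forces a hyperarc to exist, so this factor is positive too and every [maxn 1]
     can be removed. *)
  have E_gt0 : (0 < #|T| + #|E|)%N.
    rewrite addn_gt0; have [E0|E0] := posnP #|E|; last by apply/orP; right.
    by move: mA_gt0; rewrite mAE E0 big1 // => a; have := fintype0 a E0.
  rewrite -!PoszM lez_nat; apply: leq_trans m_le _.
  rewrite (maxn_idPl load1) mul1n leq_mul2l; apply/orP; right.
  by rewrite !(maxn_idPr _).
Qed.
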